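(* Let $n\ge 2$. The minimal (with respect to inclusion) building subset of $\mathcal B(n-1)$ which contains the image $\varphi\big(F^1(\mathcal N'(\mathcal C_{A_{n-1}}))\big)$ and is closed under the $S_{n+1}$ action on $\mathcal B(n-1)$ is $\mathcal B(n-1)$ itself. (Equivalently: if $\Gamma\subseteq \mathcal B(n-1)$ is a building subset that contains $\varphi\big(F^1(\mathcal N'(\mathcal C_{A_{n-1}}))\big)$ and satisfies $\sigma\Gamma\subseteq\Gamma$ for all $\sigma\in S_{n+1}$, then $\Gamma=\mathcal B(n-1)$.)
   Context: Irreducibles. Let $V=\{x\in \mathbb K^n: \sum_i x_i=0\}$ with $\mathbb K=\mathbb R$ or $\mathbb C$, containing the roots $e_i-e_j$ ($1\le i\neq j\le n$) of type $A_{n-1}$. For $I\subseteq\{1,\dots,n\}$ with $|I|\ge 2$ let $A_I$ be the span of all $e_i-e_j$ with $i,j\in I$. Put $\mathcal F_{A_{n-1}}=\{A_I : I\subseteq\{1,\dots,n\},\ |I|\ge 2\}$ (the building set of irreducibles); note $V=A_{\{1,\dots,n\}}$. We identify $A_I$ with $I$. Nested sets. A set $\mathcal S\subseteq\mathcal F_{A_{n-1}}$ is nested if for any two of its elements $A_I,A_J$ either $I\cap J=\emptyset$ or one of $I,J$ contains the other. $\mathcal B(n-1)$ is the set of all nested sets $\mathcal S\subseteq\mathcal F_{A_{n-1}}$ with $V\in\mathcal S$. Building subsets of $\mathcal B(n-1)$. For a finite set $X$, a building set of the power set of $X$ is a family of subsets of $X$ that contains all singletons $\{x\}$, $x\in X$,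 and contains $P\cup Q$ whenever it contains $P,Q$ with $P\cap Q\ne\emptyset$. Let $\mathcal A_1,\dots,\mathcal A_s$ be all the maximal nested sets of $\mathcal F_{A_{n-1}}$ (they all contain $V$), and $\mathcal A_j'=\mathcal A_j\setminus\{V\}$. A subset $\Gamma\subseteq\mathcal B(n-1)$ is a building subset if, for every $j$, the family $\{\mathcal S\setminus\{V\}: \mathcal S\in\Gamma\}\cap\{\text{subsets of }\mathcal A_j'\}$ is a building set of the power set of $\mathcal A_j'$. Concretely: $\{V,A\}\in\Gamma$ for every $A\in\mathcal F_{A_{n-1}}\setminus\{V\}$, and if $\mathcal S,\mathcal T\in\Gamma$ are such that $\mathcal S\cup\mathcal T$ is nested and $\mathcal S\cap\mathcal T\supsetneq\{V\}$, then $\mathcal S\cup\mathcal T\in\Gamma$. By convention $\{V\}$ always belongs to a building subset. The map $\varphi$. Let $\mathcal C_{A_{n-1}}$ be the set of all nonzero subspaces of $V$ spanned by a set of roots. $\mathcal N'(\mathcal C_{A_{n-1}})$ is the set of all chains (with respect to inclusion) of elements of $\mathcal C_{A_{n-1}}$ that contain $V$, and $F^1(\mathcal N'(\mathcal C_{A_{n-1}}))$ is the set of those of cardinality $2$, i.e. the sets $\{V,B\}$ with $B\in\mathcal C_{A_{n-1}}$, $B\ne V$. Each such $B$ is uniquely the direct sum $B=A_{I_1}\oplus\cdots\oplus A_{I_k}$ of the maximal elements of $\mathcal F_{A_{n-1}}$ contained in $B$ (the $I_j$ are pairwise disjoint), and $$\varphi(\{V,B\})=\{V,A_{I_1},\dots,A_{I_k}\}\in\mathcal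 B(n-1).$$ The $S_{n+1}$ action. Regard $S_{n+1}$ as the group of permutations of $\{0,1,\dots,n\}$. For $\sigma\in S_{n+1}$ put $\sigma\cdot V=V$, and for $A_I\neq V$ put $\sigma\cdot A_I=A_{\sigma(I)}$ if $0\notin\sigma(I)$ and $\sigma\cdot A_I=A_{\{0,\dots,n\}\setminus\sigma(I)}$ if $0\in\sigma(I)$. (In terms of roots: if the image $\sigma A$, computed in the root system $A_n$ on $e_0,\dots,e_n$, is not in $\mathcal F_{A_{n-1}}$, one replaces $A$ by the span $\overline A$ of all roots of $A_n$ orthogonal to $A$ and takes $\sigma\overline A$.) For $\mathcal S\in\mathcal B(n-1)$, $\sigma\mathcal S=\{\sigma\cdot A: A\in\mathcal S\}$. *)

(* Defs.v *)
From HB Require Import structures.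
From mathcomp Require Import all_boot all_order all_fingroup all_algebra.
From mathcomp Require Import finmap.

Set Implicit Arguments.
Unset Strict Implicit.
Unset Printing Implicit Defensive.

Import GRing.Theory.
Local Open Scope ring_scope.

(* The index set {1, ..., n} is 'I_n, and {0, 1, ..., n} is
   'I_n.+1, with {1, ..., n} embedded in it by [lift ord0] (so that 0 is ord0).
   An irreducible A_I is identified with I (this is justified by [spanA_sub]
   below); in particular V = A_{1, ..., n} is identified with [set: 'I_n].
   The field K is R or C in the source, and any numFieldType here. *)

Section Subspaces.
Variables (K : numFieldType) (n : nat).

Definition rootA (i j : 'I_n) : 'rV[K]_n := delta_mx 0 i - delta_mx 0 j.

Definition rootsA : seq 'rV[K]_n :=
  [seq rootA p.1 p.2 | p in [pred p : 'I_n * 'I_n | p.1 != p.2]].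

(* The hyperplane \sum_i x_i = 0; see [mem_Vsp]. *)
Definition Vsp : {vspace 'rV[K]_n} :=
  lker (linfun (mulmxr (const_mx 1 : 'M[K]_(n, 1)))).

(* The terms with i = j are zero, hence harmless. *)
Definition spanA (I : {set 'I_n}) : {vspace 'rV[K]_n} :=
  <<[seq rootA p.1 p.2 | p in setX I I]>>%VS.

Definition in_C (B : {vspace 'rV[K]_n}) : Prop :=
  B != 0%VS /\ exists2 s, {subset s <= rootsA} & B = <<s>>%VS.

Definition in_N' (c : {fset {vspace 'rV[K]_n}}) : Prop :=
  [/\ forall B, B \in c -> in_C B,
      {in c &, forall B1 B2, (B1 <= B2)%VS || (B2 <= B1)%VS}
    & Vsp \in c].

Definition in_F1 (c : {fset {vspace 'rV[K]_n}}) : Prop :=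
  in_N' c /\ #|` c| = 2%N.

End Subspaces.

Section NestedSets.
Variable n : nat.

Definition irreds : {set {set 'I_n}} := [set I : {set 'I_n} | 1 < #|I|]%N.

Definition nested (S : {set {set 'I_n}}) : bool :=
  (S \subset irreds) &&
  [forall I : {set 'I_n} in S, forall J : {set 'I_n} in S,
     [|| [disjoint I & J], I \subset J | J \subset I]].

(* This is B(n-1): its elements are the nested sets containing V. *)
Definition nestedV : {set {set {set 'I_n}}} :=
  [set S : {set {set 'I_n}} | nested S && ([set: 'I_n] \in S)].

End NestedSets.

Definition building_set (T : finType) (X : {set T}) (G : {set {set T}}) : Prop :=
  [/\ G \subset powerset X,
      forall x, x \in X -> [set x] \in G
    & forall P Q, P \in G -> Q \in G -> P :&: Q != set0 -> P :|: Q \in G].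

(* A building set of a power set may or may not contain the empty set, so the
   first two clauses do not decide whether {V} is in Gamma; the last clause is
   the convention that it always is. *)
Definition building_subset (n : nat) (Gamma : {set {set {set 'I_n}}}) : Prop :=
  [/\ Gamma \subset nestedV n,
      forall A : {set {set 'I_n}}, maxset (@nested n) A ->
        building_set (A :\ [set: 'I_n])
          ([set S :\ [set: 'I_n] | S in Gamma] :&: powerset (A :\ [set: 'I_n]))
    & [set [set: 'I_n]] \in Gamma].

(* Maximality is for inclusion of the subspaces A_I. *)
Definition max_irreds (K : numFieldType) (n : nat) (B : {vspace 'rV[K]_n}) :
    {set {set 'I_n}} :=
  [set I in irreds n | (spanA K I <= B)%VS &
     [forall J : {set 'I_n} in irreds n,
        (spanA K J <= B)%VS && (spanA K I <= spanA K J)%VS ==> (J == I)]].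

(* On a chain c = {V, B} with B != V, the union has the single term
   [max_irreds B]. *)
Definition phi (K : numFieldType) (n : nat) (c : {fset {vspace 'rV[K]_n}}) :
    {set {set 'I_n}} :=
  [set: 'I_n] |: \bigcup_(B <- c | B != Vsp K n) max_irreds B.

(* The inner if is evaluated in {0, ..., n} and the preimage by [lift ord0]
   reads the result, which does not contain 0, back in {1, ..., n}. *)
Section Action.
Variable n : nat.
Implicit Types (sigma : 'S_n.+1) (I : {set 'I_n}) (S : {set {set 'I_n}}).

Definition act_irred sigma I : {set 'I_n} :=
  if I == [set: 'I_n] then [set: 'I_n] else
  let J := [set sigma (lift ord0 i) | i in I] in
  lift ord0 @^-1: (if ord0 \in J then ~: J else J).

Definition act_nested sigma S : {set {set 'I_n}} :=
  [set act_irred sigma I | I in S].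

End Action.

Definition admissible (K : numFieldType) (n : nat)
    (Gamma : {set {set {set 'I_n}}}) : Prop :=
  [/\ building_subset Gamma,
      forall c : {fset {vspace 'rV[K]_n}}, in_F1 c -> phi c \in Gamma
    & forall (sigma : 'S_n.+1) S, S \in Gamma -> act_nested sigma S \in Gamma].

Section Facts.
Variables (K : numFieldType) (n : nat).

Lemma mem_Vsp (x : 'rV[K]_n) : (x \in Vsp K n) = (\sum_i x 0 i == 0).
Proof.
have sumE : \sum_i x 0 i = (x *m (const_mx 1 : 'M[K]_(n, 1))) 0 0.
  by rewrite mxE; apply: eq_bigr => i _; rewrite mxE mulr1.
rewrite memv_ker lfunE /= sumE; apply/eqP/eqP => [->|h]; first by rewrite mxE.
by apply/matrixP=> a b; rewrite !ord1 h mxE.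
Qed.

Lemma rootA_spanA (I : {set 'I_n}) i j :
  i \in I -> j \in I -> rootA K i j \in spanA K I.
Proof.
move=> iI jI; apply: memv_span; apply/imageP.
by exists (i, j); rewrite // inE /= iI jI.
Qed.

Lemma spanA_supp (I : {set 'I_n}) x k :
  x \in spanA K I -> k \notin I -> x 0 k = 0.
Proof.
move=> xI kI; rewrite (coord_span (X := in_tuple _) xI) summxE big1 // => a _.
rewrite mxE; set r := _`_a.
have /imageP[[i j]] : r \in [seq rootA K p.1 p.2 | p in setX I I].
  exact: mem_nth.
rewrite inE /= => /andP[iI jI] ->; rewrite !mxE.
rewrite ![k == _]eq_sym (negPf (memPn kI _ iI)) (negPf (memPn kI _ jI)).
by rewrite subrr mulr0.
Qed.

Lemma spanA_sub (I J : {set 'I_n}) :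
  I \in irreds n -> (spanA K I <= spanA K J)%VS = (I \subset J).
Proof.
rewrite inE => I2; apply/idP/idP => [sIJ|/subsetP sIJ].
  apply/subsetP=> i iI; apply: contraT => iJ.
  have [j] : exists j, j \in I :\ i.
    by apply/card_gt0P; move: I2; rewrite (cardsD1 i) iI.
  rewrite !inE => /andP[ji jI].
  have /spanA_supp/(_ iJ) := subvP sIJ _ (rootA_spanA iI jI).
  by rewrite !mxE !eqxx [i == j]eq_sym (negPf ji) /= subr0 => /eqP; rewrite oner_eq0.
apply/span_subvP=> _ /imageP[[i j] + ->]; rewrite inE /= => /andP[iI jI].
by apply: rootA_spanA; apply: sIJ.
Qed.

Lemma spanA_setT : spanA K [set: 'I_n] = Vsp K n.
Proof.
apply/eqP; rewrite eqEsubv; apply/andP; split.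
  apply/span_subvP=> _ /imageP[[i j] _ ->]; rewrite mem_Vsp /=.
  under eq_bigr do rewrite !mxE eqxx /=.
  rewrite sumrB (bigD1 i) //= (bigD1 (P := xpredT) j) //= !eqxx.
  rewrite !big1 ?subrr // => k; by [move/negPf=> -> | rewrite -?eq_sym => /negPf ->].
apply/subvP=> x; rewrite mem_Vsp => /eqP x0.
have [i0|] := pickP 'I_n; last first.
  move=> n0; suff -> : x = 0 by apply: mem0v.
  by apply/rowP=> i; have := n0 i.
move=> _; suff -> : x = \sum_i x 0 i *: rootA K i i0.
  by apply: memv_suml => i _; apply: memvZ; apply: rootA_spanA; rewrite inE.
under eq_bigr do rewrite scalerBr.
by rewrite sumrB -scaler_suml x0 scale0r subr0 -row_sum_delta.
Qed.

End Facts.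

(* Main.v *)
Require Import Defs.
From mathcomp Require Import all_boot all_order all_algebra.
From mathcomp Require Import perm finmap.

(** Add a root 0 to the leaves 1, ..., n: a nested set containing V is then a
    tree with leaves 0, ..., n, and each of its elements A_I other than V is an
    inner edge, which splits {0, ..., n} into I and its complement (each part
    having at least two leaves).  The group S_{n+1} permutes the leaves, and
    [act_irred] reads a split off the part that avoids 0.

    That all of B(n-1) is admissible rests on this picture: two irreducibles
    are compatible exactly when a part of the first split is disjoint from a
    part of the second ([compatible_sideP]), a condition in which 0 plays no
    special role, so S_{n+1} preserves it ([nestedV_act]).  The image of phi
    is nested because roots indexed by two overlapping sets generate the roots
    indexed by their union ([nested_max_irreds]).

    Conversely, let Gamma be admissible and S a nested set with k elements
    other than V.
    - If k <= 1, then S is in Gamma because Gamma is a building subset.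
    - If k = 2 and S = {V, I, J} with I and J disjoint, then S is the image
      under phi of the chain with smaller term A_I + A_J ([phi_pair]).
    - If k = 2 and I is strictly contained in J, take i in J outside I.  The
      transposition (0 i) fixes A_I and carries the irreducible with index set
      (complement of J) + i, which is disjoint from I, to A_J
      ([act_irred_tperm], [act_irred_tpermC]); so S is the image of a nested
      set of the previous kind.
    - If k >= 3, remove from S two distinct elements in turn.  The two smaller
      nested sets are in Gamma by induction, they share more than V, and their
      union is S.  *)

Set Implicit Arguments.
Unset Strict Implicit.
Unset Printing Implicit Defensive.

Import GRing.Theory.

(** * Nested sets *)

Section Nested.
Variable n : nat.
Implicit Types (I J : {set 'I_n}) (S T : {set {set 'I_n}}).

Definition compatible I J := [|| [disjoint I & J], I \subset J | J \subset I].

Lemma compatible_sym I J : compatible I J = compatible J I.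
Proof. by rewrite /compatible disjoint_sym [(I \subset J) || _]orbC. Qed.

Lemma compatible_setT I : compatible I [set: 'I_n].
Proof. by rewrite /compatible subsetT orbT. Qed.

Lemma nestedP S :
  reflect ({in S, forall I, 1 < #|I|} /\ {in S &, forall I J, compatible I J})
          (nested S).
Proof.
apply: (iffP andP) => [[/subsetP irrS /forall_inP compS]|[irrS compS]]; split.
- by move=> I /irrS; rewrite inE.
- by move=> I J IS JS; have /forall_inP := compS I IS; apply.
- by apply/subsetP=> I IS; rewrite inE irrS.
- by apply/forall_inP=> I IS; apply/forall_inP=> J JS; apply: compS.
Qed.

Lemma nestedW S T : S \subset T -> nested T -> nested S.
Proof.
move=> /subsetP sST /nestedP[irrT compT]; apply/nestedP; split.
  by move=> I /sST; apply: irrT.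
by move=> I J /sST IT /sST JT; apply: compT.
Qed.

Lemma nestedV_setT S : 1 < n -> nested S -> [set: 'I_n] |: S \in nestedV n.
Proof.
move=> n_gt1 /nestedP[irrS compS]; rewrite !inE eqxx andbT.
apply/nestedP; split=> [I|I J]; rewrite !inE.
  by case/predU1P=> [->|/irrS //]; rewrite cardsT card_ord.
case/predU1P=> [->|IS]; first by rewrite compatible_sym compatible_setT.
by case/predU1P=> [->|JS]; [apply: compatible_setT | apply: compS].
Qed.

Lemma nested_pair I J :
  1 < #|I| -> 1 < #|J| -> compatible I J -> nested [set I; J].
Proof.
move=> I2 J2 cIJ; apply/nestedP; split=> [H|H H']; rewrite !inE.
  by case/pred2P=> ->.
have cxx (A : {set 'I_n}) : compatible A A.
  by rewrite /compatible subxx !orbT.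
by case/pred2P=> ->; case/pred2P=> ->; rewrite // compatible_sym.
Qed.

End Nested.

(** * Building subsets *)

Section BuildingSubset.
Variable n : nat.
Implicit Types (I J : {set 'I_n}) (S T : {set {set 'I_n}}).
Implicit Type Gamma : {set {set {set 'I_n}}}.

Lemma trace_mem Gamma S : Gamma \subset nestedV n -> [set: 'I_n] \in S ->
  (S :\ [set: 'I_n] \in [set T :\ [set: 'I_n] | T in Gamma]) = (S \in Gamma).
Proof.
move=> /subsetP sG VS; apply/imsetP/idP => [[T TG eqST]|]; last by exists S.
have VT : [set: 'I_n] \in T by have := sG T TG; rewrite inE => /andP[].
by rewrite -(setD1K VS) eqST setD1K.
Qed.

Lemma building_subset_setU Gamma S T : building_subset Gamma ->
    S \in Gamma -> T \in Gamma -> nested (S :|: T) ->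
    (S :\ [set: 'I_n]) :&: (T :\ [set: 'I_n]) != set0 ->
  S :|: T \in Gamma.
Proof.
case=> sG bG _ SG TG nU ST0.
have [A maxA sUA] := maxset_exists nU.
have [_ _ closed_setU] := bG A maxA.
have VU : [set: 'I_n] \in S :|: T.
  by have := subsetP sG S SG; rewrite !inE => /andP[_ ->].
have mem_tr R : R \in Gamma -> R \subset A ->
    R :\ [set: 'I_n] \in [set T :\ [set: 'I_n] | T in Gamma]
                           :&: powerset (A :\ [set: 'I_n]).
  by move=> RG sRA; rewrite in_setI powersetE setSD // andbT; apply/imsetP; exists R.
have [sSA sTA] : S \subset A /\ T \subset A by apply/andP; rewrite -subUset.
have := closed_setU _ _ (mem_tr S SG sSA) (mem_tr T TG sTA) ST0.
by rewrite -setDUl inE trace_mem // => /andP[].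
Qed.

Lemma building_subset_atom Gamma I : building_subset Gamma ->
    1 < #|I| -> I != [set: 'I_n] ->
  [set [set: 'I_n]; I] \in Gamma.
Proof.
case=> sG bG _ I2 IV.
have n1 : nested [set I].
  by rewrite -(setUid [set I]) nested_pair // /compatible subxx !orbT.
have [A maxA sIA] := maxset_exists n1.
have [_ atoms _] := bG A maxA.
have IA : I \in A :\ [set: 'I_n] by rewrite !inE IV -sub1set.
have IE : [set [set: 'I_n]; I] :\ [set: 'I_n] = [set I].
  by rewrite setU1K // inE eq_sym.
by rewrite -(trace_mem sG (set21 _ _)) IE; case/setIP: (atoms I IA).
Qed.

Lemma nestedV_building : 1 < n -> building_subset (nestedV n).
Proof.
move=> n_gt1; split=> // [A maxA|]; last first.
  by rewrite -(setU0 [set _]) nestedV_setT //; apply/nestedP; split=> I; rewrite inE.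
have nA := maxsetp maxA.
(* Subsets of a nested set are nested, so the trace of B(n-1) on A \ {V} is the
   whole power set. *)
have trE P : (P \in [set S :\ [set: 'I_n] | S in nestedV n]
                      :&: powerset (A :\ [set: 'I_n]))
             = (P \subset A :\ [set: 'I_n]).
  rewrite inE powersetE andb_idl // subsetD1 => /andP[sPA VP].
  apply/imsetP; exists ([set: 'I_n] |: P); last by rewrite setU1K.
  exact: nestedV_setT (nestedW sPA nA).
split=> [|I|P Q]; rewrite ?trE ?subsetIr ?sub1set //.
by move=> PA QA _; rewrite subUset PA.
Qed.

End BuildingSubset.

(** * The action of the symmetric group on splits *)

Section Splits.
Variable n : nat.
Implicit Types (I J : {set 'I_n}) (S : {set {set 'I_n}}) (sigma : 'S_n.+1).

(** The part without 0 of the split of {0, ..., n} given by [I]. *)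
Definition side I : {set 'I_n.+1} := [set lift ord0 i | i in I].

Lemma side_lift I i : (lift ord0 i \in side I) = (i \in I).
Proof. by rewrite mem_imset //; apply: lift_inj. Qed.

Lemma side0 I : (ord0 \in side I) = false.
Proof. by apply/imsetP=> -[i _ /eqP]; rewrite eq_liftF. Qed.

Lemma ord_S_cases (P : 'I_n.+1 -> Prop) :
  P ord0 -> (forall i, P (lift ord0 i)) -> forall x, P x.
Proof. by move=> P0 PS x; case: (unliftP ord0 x) => [i|] ->. Qed.

(** A split is moved by [sigma] as a partition, and then complemented if this is
    needed to make 0 fall outside. *)
Lemma side_act sigma I x : I != [set: 'I_n] ->
  (x \in side (act_irred sigma I))
    = (((sigma^-1)%g x \in side I) (+) ((sigma^-1)%g ord0 \in side I)).
Proof.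
move=> /negPf IV; rewrite /act_irred IV.
set A := imset _ _.
have AE y : (y \in A) = ((sigma^-1)%g y \in side I).
  by rewrite /A (imset_comp sigma (lift ord0)) -{1}(permKV sigma y) mem_imset //;
    apply: perm_inj.
elim/ord_S_cases: x => [|i]; first by rewrite side0 addbb.
by rewrite side_lift inE -!AE; case: ifP => _; rewrite ?inE ?addbT ?addbF.
Qed.

(** Compatibility is a statement about unordered splits: the four-part common
    refinement of the two splits has an empty part.  The
    intersection of the two parts containing 0 is never empty, which leaves the
    three cases of [compatible]. *)
Lemma compatible_sideP I J :
  reflect (exists a b, forall x, ~~ (((x \in side I) == a) && ((x \in side J) == b)))
          (compatible I J).
Proof.
apply: (iffP or3P) => [[]|[[] [[]]] h].
- move=> dIJ; exists true, true; elim/ord_S_cases=> [|i]; first by rewrite side0.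
  rewrite !side_lift; apply/negP=> /andP[/eqP iI /eqP iJ].
  by rewrite (disjointFr dIJ iI) in iJ.
- move=> /subsetP sIJ; exists true, false.
  elim/ord_S_cases=> [|i]; first by rewrite side0.
  by rewrite !side_lift; apply/negP=> /andP[/eqP/sIJ ->].
- move=> /subsetP sJI; exists false, true.
  elim/ord_S_cases=> [|i]; first by rewrite !side0.
  by rewrite !side_lift; apply/negP=> /andP[+ /eqP/sJI] => /[swap] ->.
- constructor 1; apply/pred0P=> i /=; have := h (lift ord0 i).
  by rewrite !side_lift !eqb_id => /negPf.
- constructor 2; apply/subsetP=> i iI; have := h (lift ord0 i).
  by rewrite !side_lift iI; case: (i \in J).
- constructor 3; apply/subsetP=> i iJ; have := h (lift ord0 i).
  by rewrite !side_lift iJ; case: (i \in I).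
- by have := h ord0; rewrite !side0.
Qed.

Lemma compatible_act sigma I J : I != [set: 'I_n] -> J != [set: 'I_n] ->
  compatible I J -> compatible (act_irred sigma I) (act_irred sigma J).
Proof.
move=> IV JV /compatible_sideP[a [b h]]; apply/compatible_sideP.
exists (a (+) ((sigma^-1)%g ord0 \in side I)), (b (+) ((sigma^-1)%g ord0 \in side J)).
move=> x; rewrite !side_act //; have := h ((sigma^-1)%g x).
by do 2!case: (_ \in side I); do 2!case: (_ \in side J); case: a {h}; case: b.
Qed.

(** Both parts of the split of a proper irreducible have at least two leaves:
    the part with 0 also contains an index outside [I]. *)
Lemma irred_sides I a : 1 < #|I| -> I != [set: 'I_n] ->
  exists x y, [/\ x != y, (x \in side I) = a & (y \in side I) = a].
Proof.
case: a => [/card_gt1P[i [j [iI jI ij]]] _|_].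
  by exists (lift ord0 i), (lift ord0 j); rewrite !side_lift (inj_eq lift_inj).
rewrite -subTset => /subsetPn[i _ /negPf iI].
by exists ord0, (lift ord0 i); rewrite side0 side_lift neq_lift.
Qed.

Lemma card_act_irred sigma I : 1 < #|I| -> I != [set: 'I_n] ->
  1 < #|act_irred sigma I|.
Proof.
move=> I2 IV.
have [x [y [xy xI yI]]] := irred_sides (~~ ((sigma^-1)%g ord0 \in side I)) I2 IV.
have in_act z : (z \in side I) = ~~ ((sigma^-1)%g ord0 \in side I) ->
    exists2 i, i \in act_irred sigma I & sigma z = lift ord0 i.
  move=> zI; have : sigma z \in side (act_irred sigma I).
    by rewrite side_act // permK zI; case: (_ \in _).
  by case/imsetP=> i; exists i.
have [i iA xi] := in_act x xI; have [j jA yj] := in_act y yI.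
apply/card_gt1P; exists i, j; split=> //.
by apply: contraNneq xy => ij; rewrite -(inj_eq (@perm_inj _ sigma)) xi yj ij.
Qed.

Lemma act_irred_setT sigma : act_irred sigma [set: 'I_n] = [set: 'I_n].
Proof. by rewrite /act_irred eqxx. Qed.

Lemma nestedV_act sigma S : S \in nestedV n -> act_nested sigma S \in nestedV n.
Proof.
rewrite !inE => /andP[/nestedP[irrS compS] VS]; apply/andP; split; last first.
  by apply/imsetP; exists [set: 'I_n]; rewrite ?act_irred_setT.
apply/nestedP; split=> [_ /imsetP[I IS ->]|_ _ /imsetP[I IS ->] /imsetP[J JS ->]].
  have [->|IV] := eqVneq I [set: 'I_n]; last by rewrite card_act_irred ?irrS.
  by rewrite act_irred_setT; apply: irrS.
have [->|IV] := eqVneq I [set: 'I_n].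
  by rewrite act_irred_setT compatible_sym compatible_setT.
have [->|JV] := eqVneq J [set: 'I_n].
  by rewrite act_irred_setT compatible_setT.
by rewrite compatible_act ?compS.
Qed.

Lemma act_irred_tperm I i : i \notin I ->
  act_irred (tperm ord0 (lift ord0 i)) I = I.
Proof.
move=> iI; have IV : I != [set: 'I_n] by apply: contraNneq iI => ->; rewrite inE.
apply/setP=> j; rewrite -side_lift side_act // tpermV tpermL side_lift.
rewrite (negPf iI) addbF; case: tpermP; last by rewrite side_lift.
- by move=> /esym/eqP; rewrite eq_liftF.
- by move=> /lift_inj ->; rewrite side0 (negPf iI).
Qed.

Lemma act_irred_tpermC J i : i \in J -> i |: ~: J != [set: 'I_n] ->
  act_irred (tperm ord0 (lift ord0 i)) (i |: ~: J) = J.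
Proof.
move=> iJ JV; apply/setP=> j.
rewrite -side_lift side_act // tpermV tpermL side_lift !inE eqxx addbT.
case: tpermP => [/esym/eqP|/lift_inj ->|]; first by rewrite eq_liftF.
- by rewrite side0 iJ.
- move=> _ /eqP; rewrite (inj_eq lift_inj) side_lift !inE => /negPf ->.
  exact: negbK.
Qed.

End Splits.

(** * The map phi *)

Section Phi.
Variables (K : numFieldType) (n : nat).
Implicit Types (I J : {set 'I_n}) (B : {vspace 'rV[K]_n}).

Lemma spanA_setU I J : I :&: J != set0 ->
  (spanA K (I :|: J) <= spanA K I + spanA K J)%VS.
Proof.
case/set0Pn=> k /setIP[kI kJ].
have root_k i : i \in I :|: J ->
    (rootA K i k \in spanA K I + spanA K J)%VS
    /\ (rootA K k i \in spanA K I + spanA K J)%VS.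
  case/setUP=> iH; split.
  - exact: subvP (addvSl _ _) _ (rootA_spanA K iH kI).
  - exact: subvP (addvSl _ _) _ (rootA_spanA K kI iH).
  - exact: subvP (addvSr _ _) _ (rootA_spanA K iH kJ).
  - exact: subvP (addvSr _ _) _ (rootA_spanA K kJ iH).
apply/span_subvP=> _ /imageP[[i j] + ->]; rewrite inE => /andP[/= iU jU].
have -> : rootA K i j = (rootA K i k + rootA K k j)%R by rewrite addrA subrK.
by apply: memvD; [case: (root_k i iU) | case: (root_k j jU)].
Qed.

Lemma nested_max_irreds B : nested (max_irreds B).
Proof.
apply/nestedP; split=> [I|I J]; rewrite !inE; first by case/andP.
move=> /and3P[I2 IB /forall_inP maxI] /and3P[J2 JB /forall_inP maxJ].
rewrite /compatible; case: (boolP [disjoint I & J]) => //= nIJ.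
have U2 : I :|: J \in irreds n.
  by rewrite inE (leq_trans I2) // subset_leq_card // subsetUl.
have UB : (spanA K (I :|: J) <= B)%VS.
  by apply: subv_trans (spanA_setU _) _; rewrite ?setI_eq0 // subv_add IB.
have := maxI _ U2; rewrite UB spanA_sub ?inE // subsetUl => /eqP UI.
by rewrite -UI subsetUr orbT.
Qed.

Lemma phi_chain B : B != Vsp K n ->
  phi [fset Vsp K n; B]%fset = [set: 'I_n] |: max_irreds B.
Proof.
move=> BV; rewrite /phi big_mkcond big_fsetU1 /= ?inE 1?eq_sym //.
by rewrite big_seq_fset1 eqxx BV set0U.
Qed.

Lemma in_F1_chain (c : {fset {vspace 'rV[K]_n}}) : in_F1 c ->
  exists2 B, B != Vsp K n & c = [fset Vsp K n; B]%fset.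
Proof.
case=> -[_ _ Vc] /eqP; rewrite (cardfsD1 (Vsp K n)) Vc eqSS.
move=> /cardfs1P[B cB]; exists B; last by rewrite -cB fsetD1K.
have : B \in (c `\ Vsp K n)%fset by rewrite cB inE.
by rewrite !inE => /andP[].
Qed.

Lemma phi_nestedV (c : {fset {vspace 'rV[K]_n}}) : 1 < n -> in_F1 c -> phi c \in nestedV n.
Proof.
move=> n_gt1 /in_F1_chain[B BV ->].
by rewrite phi_chain // nestedV_setT // nested_max_irreds.
Qed.

(** Discarding the zero vectors from the generators of [spanA] leaves roots. *)
Lemma spanA_roots I :
  exists2 s, {subset s <= rootsA K n} & spanA K I = <<s>>%VS.
Proof.
exists [seq v <- [seq rootA K p.1 p.2 | p in setX I I] | v != 0%R].
  move=> v; rewrite mem_filter => /andP[v0 /imageP[[i j] _ vE]].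
  apply/imageP; exists (i, j) => //; rewrite inE /=.
  by apply: contraNneq v0 => ij; rewrite vE ij /rootA subrr.
apply/eqP; rewrite eqEsubv; apply/andP; split; apply/span_subvP=> v vs.
  have [->|v0] := eqVneq v 0%R; first exact: mem0v.
  by apply: memv_span; rewrite mem_filter v0.
by apply: memv_span; move: vs; rewrite mem_filter => /andP[].
Qed.

Lemma spanA_neq0 I : 1 < #|I| -> spanA K I != 0%VS.
Proof.
case/card_gt1P=> i [j [iI jI ij]].
apply: contraTneq (rootA_spanA K iI jI) => ->; rewrite memv0.
apply/eqP => /rowP/(_ i); rewrite !mxE !eqxx (negPf ij) subr0 => /eqP.
by rewrite oner_eq0.
Qed.

Lemma in_C_setT : 1 < n -> in_C (Vsp K n).
Proof.
move=> n_gt1; rewrite -spanA_setT; split; last exact: spanA_roots.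
by rewrite spanA_neq0 // cardsT card_ord.
Qed.

Lemma in_C_add I J : 1 < #|I| -> in_C (spanA K I + spanA K J)%VS.
Proof.
move=> I2; split.
  apply: contraNneq (spanA_neq0 I2) => IJ0; rewrite -subv0 -IJ0; exact: addvSl.
have [s sR ->] := spanA_roots I; have [t tR ->] := spanA_roots J.
exists (s ++ t); last by rewrite span_cat.
by move=> v; rewrite mem_cat => /orP[/sR|/tR].
Qed.

(** A root of A_I + A_J with one index in [I] has both: the sum of the
    coordinates over [I] vanishes on A_I + A_J when [I] and [J] are disjoint. *)
Lemma root_add_disjoint I J i j : [disjoint I & J] ->
  (rootA K i j \in spanA K I + spanA K J)%VS -> i \in I -> j \in I.
Proof.
move=> dIJ /memv_addP[u uI [v vJ uv]] iI.
have sum_u : (\sum_(k in I) u 0 k = 0)%R.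
  have : u \in Vsp K n.
    rewrite -spanA_setT; apply: subvP uI; apply/span_subvP=> _ /imageP[p _ ->].
    by rewrite rootA_spanA ?inE.
  rewrite mem_Vsp (bigID (mem I)) /= addrC big1 ?add0r => [/eqP //|k kI].
  exact: spanA_supp uI kI.
have sum_v : (\sum_(k in I) v 0 k = 0)%R.
  by apply: big1 => k kI; apply: spanA_supp vJ _; rewrite (disjointFr dIJ kI).
have : (\sum_(k in I) rootA K i j 0 k = 0)%R.
  by rewrite uv; under eq_bigr do rewrite mxE; rewrite big_split /= sum_u sum_v addr0.
apply: contra_eqT => jI; rewrite (bigD1 i) //= !mxE !eqxx.
rewrite (negPf (memPn jI _ iI)) subr0 big1 ?addr0 ?oner_eq0 // => k /andP[kI ki].
by rewrite !mxE eqxx (negPf ki) (negPf (memPn jI _ kI)) subrr.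
Qed.

(** Every irreducible inside A_I + A_J lies inside one of the two summands, by
    [root_add_disjoint], so these are the maximal ones. *)
Lemma max_irreds_add I J : [disjoint I & J] -> 1 < #|I| -> 1 < #|J| ->
  max_irreds (spanA K I + spanA K J)%VS = [set I; J].
Proof.
move=> dIJ I2 J2.
have inside H : H \in irreds n -> (spanA K H <= spanA K I + spanA K J)%VS ->
    (H \subset I) || (H \subset J).
  rewrite inE => H2 HB.
  have /subsetP HU : H \subset I :|: J.
    rewrite -(spanA_sub K) ?inE //; apply: subv_trans HB _.
    by rewrite subv_add !spanA_sub ?inE // subsetUl subsetUr.
  have [i iH] : exists i, i \in H by apply/card_gt0P; apply: ltnW.
  have root_in k : k \in H -> (rootA K i k \in spanA K I + spanA K J)%VS.
    by move=> kH; apply: subvP HB _ (rootA_spanA K iH kH).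
  case/setUP: (HU i iH) => [iI|iJ]; apply/orP; [left|right]; apply/subsetP=> k kH.
    exact: root_add_disjoint dIJ (root_in k kH) iI.
  have root_JI : (rootA K i k \in spanA K J + spanA K I)%VS by rewrite addvC root_in.
  by apply: root_add_disjoint root_JI iJ; rewrite disjoint_sym.
have exclusive (H H' : {set 'I_n}) : [disjoint H & H'] -> 1 < #|H| -> H \subset H' = false.
  move=> /disjoint_setI0 HH' H2; apply: contraTF H2 => /setIidPl.
  by rewrite HH' => <-; rewrite cards0.
have dJI : [disjoint J & I] by rewrite disjoint_sym.
apply/setP=> H; rewrite !inE; apply/and3P/pred2P => [[H2 HB /forall_inP maxH]|].
  have Hirr : H \in irreds n by rewrite inE.
  case/orP: (inside H Hirr HB) => sH; [left|right].
    have := maxH I; rewrite inE I2 addvSl spanA_sub // sH => /(_ isT) /eqP ->.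
    by [].
  have := maxH J; rewrite inE J2 addvSr spanA_sub // sH => /(_ isT) /eqP ->.
  by [].
case=> ->; split=> //; rewrite ?addvSl ?addvSr //; apply/forall_inP=> L Lirr;
  apply/implyP=> /andP[/(inside L Lirr) LIJ]; rewrite spanA_sub ?inE // => sL.
  case/orP: LIJ => sL'; first by rewrite eqEsubset sL' sL.
  by have := subset_trans sL sL'; rewrite exclusive.
case/orP: LIJ => sL'; last by rewrite eqEsubset sL' sL.
by have := subset_trans sL sL'; rewrite exclusive.
Qed.

Lemma phi_pair I J : [disjoint I & J] -> 1 < #|I| -> 1 < #|J| ->
  exists2 c : {fset {vspace 'rV[K]_n}},
    in_F1 c & phi c = [set: 'I_n] |: [set I; J].
Proof.
move=> dIJ I2 J2; pose B := (spanA K I + spanA K J)%VS.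
have sBV : (B <= Vsp K n)%VS.
  by rewrite subv_add -!spanA_setT !spanA_sub ?inE // !subsetT.
have BV : B != Vsp K n.
  have [[i [_ [iI _ _]]] [j [_ [jJ _ _]]]] := (card_gt1P I2, card_gt1P J2).
  apply: contraFneq (disjointFl dIJ jJ) => BV.
  apply: (root_add_disjoint dIJ _ iI); rewrite -/B BV -spanA_setT.
  by rewrite rootA_spanA ?inE.
exists [fset Vsp K n; B]%fset; last by rewrite phi_chain // max_irreds_add.
have n_gt1 : 1 < n by rewrite -(card_ord n); apply: leq_trans I2 (max_card _).
split; last by rewrite cardfs2 eq_sym BV.
split=> [C|C D|]; rewrite !inE ?eqxx //.
  by case/pred2P=> ->; [apply: in_C_setT | apply: in_C_add].
by case/pred2P=> ->; case/pred2P=> ->; rewrite ?subvv ?sBV ?orbT.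
Qed.

End Phi.

(** * Admissible building subsets *)

Section Admissible.
Variables (K : numFieldType) (n : nat).
Implicit Types (I J : {set 'I_n}) (S : {set {set 'I_n}}).
Implicit Type Gamma : {set {set {set 'I_n}}}.

(** Under the transposition (0 i) with i in J outside I, the leaf 0 leaves the
    complement of J and is replaced by i; what results is an irreducible disjoint
    from I, and phi reaches the pair that it forms with I. *)
Lemma admissible_sub Gamma I J : admissible K Gamma -> 1 < #|I| ->
    J != [set: 'I_n] -> I \proper J ->
  [set: 'I_n] |: [set I; J] \in Gamma.
Proof.
move=> [_ phiG actG] I2 JV /properP[/subsetP sIJ [i iJ iI]].
have J'2 : 1 < #|i |: ~: J|.
  rewrite cardsU1 inE iJ ltnS card_gt0; apply: contra JV => /eqP JC0.
  by rewrite -(setCK J) JC0 setC0.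
have dIJ' : [disjoint I & i |: ~: J].
  apply/pred0P=> k /=; rewrite !inE; apply/negP=> /andP[kI].
  by rewrite sIJ // orbF => /eqP ki; rewrite -ki kI in iI.
have J'V : i |: ~: J != [set: 'I_n].
  have [k [_ [kI _ _]]] := card_gt1P I2.
  apply/eqP=> /setP/(_ k); rewrite [RHS]inE => kJ'.
  by have := disjointFr dIJ' kI; rewrite kJ'.
have [c c_F1 phi_c] := phi_pair K dIJ' I2 J'2.
have := actG (tperm ord0 (lift ord0 i)) _ (phiG c c_F1).
rewrite phi_c /act_nested finset.imsetU imset_set1 act_irred_setT.
by rewrite finset.imsetU !imset_set1 act_irred_tperm // act_irred_tpermC.
Qed.

Lemma admissible_pair Gamma I J : admissible K Gamma -> 1 < #|I| -> 1 < #|J| ->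
    I != J -> I != [set: 'I_n] -> J != [set: 'I_n] -> compatible I J ->
  [set: 'I_n] |: [set I; J] \in Gamma.
Proof.
move=> admG I2 J2 neqIJ IV JV /or3P[dIJ|sIJ|sJI].
- have [c c_F1 <-] := phi_pair K dIJ I2 J2.
  by case: admG => _ phiG _; apply: phiG.
- by rewrite admissible_sub // properEneq neqIJ.
- by rewrite (setUC [set I]) admissible_sub // properEneq eq_sym neqIJ.
Qed.

(** Only nested sets with at most two elements besides V need an argument of
    their own: with a third element L, dropping I and dropping J from S leaves
    two smaller nested sets that share L. *)
Lemma admissible_full Gamma S :
  admissible K Gamma -> S \in nestedV n -> S \in Gamma.
Proof.
move=> admG; have [bG _ _] := admG; have [_ _ VG] := bG.
rewrite inE => /andP[nS VS]; rewrite -(setD1K VS).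
have {VS nS} : nested (S :\ [set: 'I_n]) by apply: nestedW nS; apply: subD1set.
have : [set: 'I_n] \notin S :\ [set: 'I_n] by rewrite !inE eqxx.
move: (S :\ _) => {}S.
elim: {S}#|S| {-2}S (leqnn #|S|) => [|k IHk] S.
  by rewrite leqn0 cards_eq0 => /eqP-> _ _; rewrite setU0.
move=> Sk VS nS; have /nestedP[irrS compS] := nS.
have neqV I : I \in S -> I != [set: 'I_n] by apply: contraTneq => ->.
have [->|[I IS]] := set_0Vmem S; first by rewrite setU0.
have [SI0|[J]] := set_0Vmem (S :\ I).
  rewrite -(setD1K IS) SI0 setU0.
  by apply: building_subset_atom => //; [apply: irrS | apply: neqV].
rewrite !inE => /andP[JI JS].
have [SIJ0|[L]] := set_0Vmem (S :\ I :\ J).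
  rewrite -(setD1K IS) -(setD1K (_ : J \in S :\ I)) ?inE ?JI // SIJ0 setU0.
  by apply: admissible_pair; rewrite ?[I == J]eq_sym ?irrS ?neqV ?compS.
rewrite !inE => /and3P[LJ LI LS].
have IH H : H \in S -> [set: 'I_n] |: S :\ H \in Gamma.
  move=> HS; apply: IHk; last exact: nestedW (subD1set _ _) nS.
    by move: Sk; rewrite (cardsD1 H) HS.
  by rewrite !inE negb_and VS orbT.
have SE : [set: 'I_n] |: S = ([set: 'I_n] |: S :\ I) :|: ([set: 'I_n] |: S :\ J).
  apply/setP=> H; rewrite !inE; case: (H == _) => //=.
  rewrite -andb_orl -negb_and andb_idl // => _.
  by apply: contraNN JI => /andP[/eqP <- /eqP <-].
rewrite SE building_subset_setU ?IH // -?SE.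
  have : [set: 'I_n] |: S \in nestedV n.
    by apply: nestedV_setT nS; rewrite -(card_ord n);
      apply: leq_trans (irrS I IS) (max_card _).
  by rewrite inE => /andP[].
by apply/set0Pn; exists L; rewrite !inE LI LJ LS (negPf (neqV L LS)).
Qed.

End Admissible.

Theorem theorem6p1 (K : numFieldType) (n : nat) (hn : (2 <= n)%N) :
  admissible K (nestedV n) /\
  (forall Gamma : {set {set {set 'I_n}}},
     admissible K Gamma -> Gamma = nestedV n).
Proof.
split=> [|Gamma admG].
  split; first exact: nestedV_building.
    by move=> c; apply: phi_nestedV.
  by move=> sigma S; apply: nestedV_act.
have [[sG _ _] _ _] := admG; apply/eqP; rewrite eqEsubset sG /=.
by apply/subsetP=> S; apply: admissible_full admG.
Qed.
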